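(* Let $G$ be a solvable group of exponent $p$ and derived length $d$, where $p$ is a prime. If $p$ is odd, then $\exp(G\wedge G)$ divides $\exp(G)^{d-1}$. Otherwise, $\exp(G\wedge G)$ divides $2^{d-2}\exp(G)^{d-1}$.
   Context: $\exp(X)$ is the exponent of the group $X$ (the least positive integer $n$ with $x^n=1$ for all $x\in X$). Write ${}^{g}x=gxg^{-1}$. The nonabelian tensor square $G\otimes G$ is the group generated by symbols $g\otimes h$ ($g,h\in G$) with relations $gg'\otimes h=({}^{g}g'\otimes {}^{g}h)(g\otimes h)$ and $g\otimes hh'=(g\otimes h)({}^{h}g\otimes {}^{h}h')$ for all $g,g',h,h'\in G$. The exterior square $G\wedge G$ is the quotient of $G\otimes G$ by the subgroup generated by all $x\otimes x$, $x\in G$.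
   Formalization: The derived length d is assumed to be at least 2: for d = 1 and p odd the claim fails (G = C_p × C_p has exp(G∧G) = p, not dividing 1), and for p = 2 (where G is abelian, d = 1) the bound 2^{d-2}exp(G)^{d-1} = 1/2 is not an integer. *)

(* Defs.v *)
From HB Require Import structures.
From mathcomp Require Import all_boot.
From mathcomp Require Import boolp classical_sets.

Set Implicit Arguments.
Unset Strict Implicit.
Unset Printing Implicit Defensive.

Local Open Scope classical_set_scope.
Local Open Scope quotient_scope.
Local Open Scope group_scope.

(* Groups are arbitrary, possibly infinite: [groupType] of boot/monoid.v. *)

Section Subgroups.
Variable G : groupType.

Definition is_subgroup (A : set G) : Prop :=
  [/\ A 1, forall x y, A x -> A y -> A (x * y) & forall x, A x -> A x^-1].

Definition generated (S : set G) : set G := smallest is_subgroup S.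

Lemma generated_subgroup S : is_subgroup (generated S).
Proof.
split=> [A [[]//] | x y Sx Sy A AP | x Sx A AP]; case: (AP) => -[_ AM AV] _.
  by apply: AM; [apply: Sx | apply: Sy].
by apply: AV; apply: Sx.
Qed.

Lemma sub_generated S : S `<=` generated S.
Proof. by move=> x Sx A [_]; apply. Qed.

Lemma generated_min S A : is_subgroup A -> S `<=` A -> generated S `<=` A.
Proof. by move=> sgA SA x; apply. Qed.

Fixpoint derived_series (n : nat) : set G :=
  if n is m.+1 then
    generated [set z | exists x y, [/\ derived_series m x,
                                       derived_series m y & z = [~ x, y]]]
  else setT.

Definition is_solvable : Prop := exists n, derived_series n = [set 1].

(* The junk value is 0 when [G] is not solvable. *)
Definition derived_length : nat :=
  if pselect (exists n, `[< derived_series n = [set 1] >]) is left ex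
  then ex_minn ex else 0.

(* The junk value is 0 when no positive [n] kills [G], so that, for [m > 0],
   [group_exponent G %| m] entails that the exponent of [G] is finite. *)
Definition group_exponent : nat :=
  if pselect (exists n, `[< (0 < n)%N /\ forall x : G, x ^+ n = 1 >]) is left ex
  then ex_minn ex else 0.

(* The left action of the group on itself, as opposed to [x ^ g], which is
   [g^-1 * x * g]. *)
Definition lconj (g x : G) : G := g * x * g^-1.

Lemma lconjM g x y : lconj g (x * y) = lconj g x * lconj g y.
Proof. by rewrite /lconj !mulgA mulgVK. Qed.

Lemma lconjJ g h x : lconj g (lconj h x) = lconj (g * h) x.
Proof. by rewrite /lconj invgM !mulgA. Qed.

Lemma lconjK g x : lconj g (lconj g^-1 x) = x.
Proof. by rewrite lconjJ mulgV /lconj mul1g invg1 mulg1. Qed.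

End Subgroups.

Section Presentation.
Variables (X : choiceType).

(* [(true, x)] stands for the generator [x] and [(false, x)] for its inverse. *)
Definition word : Type := seq (bool * X).

Definition inv_word (w : word) : word := rev [seq (~~ l.1, l.2) | l <- w].

Variable R : word -> word -> Prop.

Inductive word_congr : word -> word -> Prop :=
| wc_rel u v : R u v -> word_congr u v
| wc_cancel b x : word_congr [:: (b, x); (~~ b, x)] [::]
| wc_cat u u' v v' :
    word_congr u u' -> word_congr v v' -> word_congr (u ++ v) (u' ++ v')
| wc_refl u : word_congr u u
| wc_sym u v : word_congr u v -> word_congr v u
| wc_trans u v w : word_congr u v -> word_congr v w -> word_congr u w.

Definition word_congrb : rel word := fun u v => `[< word_congr u v >].

Lemma word_congrb_refl : reflexive word_congrb.
Proof. by move=> u; apply/asboolP; apply: wc_refl. Qed.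

Lemma word_congrb_sym : symmetric word_congrb.
Proof. by move=> u v; apply/asboolP/asboolP; apply: wc_sym. Qed.

Lemma word_congrb_trans : transitive word_congrb.
Proof.
by move=> v u w /asboolP uv /asboolP vw; apply/asboolP; apply: wc_trans vw.
Qed.

Canonical word_equiv :=
  EquivRel word_congrb word_congrb_refl word_congrb_sym word_congrb_trans.

Definition presented : Type := {eq_quot word_equiv}.
HB.instance Definition _ := Choice.on presented.
HB.instance Definition _ := Quotient.on presented.

Definition pclass (w : word) : presented := \pi_presented w.

Lemma pclassP u v : pclass u = pclass v <-> word_congr u v.
Proof.
by split=> [/eqmodP/asboolP | uv]; last by apply/eqmodP/asboolP.
Qed.

Lemma pclass_repr a : pclass (repr a) = a.
Proof. exact: reprK. Qed.

Lemma repr_pclass w : word_congr (repr (pclass w)) w.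
Proof. by apply/pclassP; rewrite pclass_repr. Qed.

Lemma inv_word_cat u v : inv_word (u ++ v) = inv_word v ++ inv_word u.
Proof. by rewrite /inv_word map_cat rev_cat. Qed.

Lemma inv_wordK : involutive inv_word.
Proof.
move=> w; rewrite /inv_word map_rev revK -map_comp.
by rewrite -[RHS]map_id; apply: eq_map => -[b x] /=; rewrite negbK.
Qed.

Lemma word_congrVr w : word_congr (w ++ inv_word w) [::].
Proof.
elim: w => [|[b x] w IHw]; first exact: wc_refl.
rewrite -cat1s inv_word_cat catA -(catA _ w).
apply: wc_trans (wc_cancel b x).
exact: (wc_cat (wc_cat (wc_refl [:: (b, x)]) IHw) (wc_refl [:: (~~ b, x)])).
Qed.

Lemma word_congrVl w : word_congr (inv_word w ++ w) [::].
Proof. by rewrite -{2}[w]inv_wordK; apply: word_congrVr. Qed.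

Definition pmul (a b : presented) : presented := pclass (repr a ++ repr b).
Definition pone : presented := pclass [::].
Definition pinv (a : presented) : presented := pclass (inv_word (repr a)).

Lemma pmulE u v : pmul (pclass u) (pclass v) = pclass (u ++ v).
Proof. by apply/pclassP; apply: wc_cat; apply: repr_pclass. Qed.

Lemma pmulA : associative pmul.
Proof.
move=> a b c; rewrite -(pclass_repr a) -(pclass_repr b) -(pclass_repr c).
by rewrite !pmulE catA.
Qed.

Lemma pmul1 : left_id pone pmul.
Proof. by move=> a; rewrite -(pclass_repr a) pmulE. Qed.

Lemma pmulr1 : right_id pone pmul.
Proof. by move=> a; rewrite -(pclass_repr a) pmulE cats0. Qed.

Lemma pmulVl : left_inverse pone pinv pmul.
Proof.
move=> a; rewrite -{2}(pclass_repr a) pmulE.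
by apply/pclassP; apply: word_congrVl.
Qed.

Lemma pmulVr : right_inverse pone pinv pmul.
Proof.
move=> a; rewrite -{1}(pclass_repr a) pmulE.
by apply/pclassP; apply: word_congrVr.
Qed.

HB.instance Definition _ :=
  isGroup.Build presented pmulA pmul1 pmulr1 pmulVl pmulVr.

Lemma pclassM u v : pclass (u ++ v) = pclass u * pclass v.
Proof. by rewrite -pmulE. Qed.

End Presentation.

Section QuotientGroup.
Variable G : groupType.

Record normal_subgroup := NormalSubgroup {
  normal_set : set G;
  normal_is_subgroup : is_subgroup normal_set;
  normal_lconj : forall g x, normal_set x -> normal_set (lconj g x)
}.

Variable N : normal_subgroup.

Definition coset_eqb : rel G := fun x y => `[< normal_set N (x^-1 * y) >].

Lemma coset_eqb_refl : reflexive coset_eqb.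
Proof. by move=> x; apply/asboolP; rewrite mulVg; case: (normal_is_subgroup N). Qed.

Lemma coset_eqb_sym : symmetric coset_eqb.
Proof.
have [_ _ NV] := normal_is_subgroup N.
by move=> x y; apply/asboolP/asboolP => /NV; rewrite invgM invgK.
Qed.

Lemma coset_eqb_trans : transitive coset_eqb.
Proof.
have [_ NM _] := normal_is_subgroup N.
move=> y x z /asboolP xy /asboolP yz; apply/asboolP.
by have := NM _ _ xy yz; rewrite mulgA mulgK.
Qed.

Canonical coset_equiv :=
  EquivRel coset_eqb coset_eqb_refl coset_eqb_sym coset_eqb_trans.

Definition quotient_group : Type := {eq_quot coset_equiv}.
HB.instance Definition _ := Choice.on quotient_group.
HB.instance Definition _ := Quotient.on quotient_group.

Definition qclass (x : G) : quotient_group := \pi_quotient_group x.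

Lemma qclassP x y : qclass x = qclass y <-> normal_set N (x^-1 * y).
Proof.
by split=> [/eqmodP/asboolP | xy]; last by apply/eqmodP/asboolP.
Qed.

Lemma qclass_repr a : qclass (repr a) = a.
Proof. exact: reprK. Qed.

Definition qmul (a b : quotient_group) : quotient_group :=
  qclass (repr a * repr b).
Definition qone : quotient_group := qclass 1.
Definition qinv (a : quotient_group) : quotient_group := qclass (repr a)^-1.

Lemma qmulE x y : qmul (qclass x) (qclass y) = qclass (x * y).
Proof.
have [_ NM _] := normal_is_subgroup N.
rewrite /qmul; set x' := repr _; set y' := repr _.
have /qclassP Nx : qclass x' = qclass x by apply: qclass_repr.
have /qclassP Ny : qclass y' = qclass y by apply: qclass_repr.
apply/qclassP; have := NM _ _ (normal_lconj y'^-1 Nx) Ny.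
by rewrite /lconj invgK invgM !mulgA mulgK.
Qed.

Lemma qmulA : associative qmul.
Proof.
move=> a b c; rewrite -(qclass_repr a) -(qclass_repr b) -(qclass_repr c).
by rewrite !qmulE mulgA.
Qed.

Lemma qmul1 : left_id qone qmul.
Proof. by move=> a; rewrite -(qclass_repr a) qmulE mul1g. Qed.

Lemma qmulr1 : right_id qone qmul.
Proof. by move=> a; rewrite -(qclass_repr a) qmulE mulg1. Qed.

Lemma qmulVl : left_inverse qone qinv qmul.
Proof. by move=> a; rewrite -{2}(qclass_repr a) qmulE mulVg. Qed.

Lemma qmulVr : right_inverse qone qinv qmul.
Proof. by move=> a; rewrite -{1}(qclass_repr a) qmulE mulgV. Qed.

HB.instance Definition _ :=
  isGroup.Build quotient_group qmulA qmul1 qmulr1 qmulVl qmulVr.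

Lemma qclassM x y : qclass (x * y) = qclass x * qclass y.
Proof. by rewrite -qmulE. Qed.

End QuotientGroup.

Section TensorSquare.
Variable G : groupType.

Definition tensor_word (g h : G) : word (G * G)%type := [:: (true, (g, h))].

Inductive tensor_rel : word (G * G)%type -> word (G * G)%type -> Prop :=
| tensor_relMl g g' h :
    tensor_rel (tensor_word (g * g') h)
               (tensor_word (lconj g g') (lconj g h) ++ tensor_word g h)
| tensor_relMr g h h' :
    tensor_rel (tensor_word g (h * h'))
               (tensor_word g h ++ tensor_word (lconj h g) (lconj h h')).

Definition tensor_square : groupType := presented tensor_rel.

Definition tensor (g h : G) : tensor_square := pclass tensor_rel (tensor_word g h).

Lemma tensorMl g g' h :
  tensor (g * g') h = tensor (lconj g g') (lconj g h) * tensor g h.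
Proof. by rewrite /tensor -pclassM; apply/pclassP/wc_rel; constructor. Qed.

Lemma tensorMr g h h' :
  tensor g (h * h') = tensor g h * tensor (lconj h g) (lconj h h').
Proof. by rewrite /tensor -pclassM; apply/pclassP/wc_rel; constructor. Qed.

(* Both expansions of [tensor (g * g') (h * h')] agree. *)
Lemma tensor_exchange g g' h h' :
  tensor (lconj (g * h) g') (lconj (g * h) h') * tensor g h =
  tensor g h * tensor (lconj (h * g) g') (lconj (h * g) h').
Proof.
have lconjl (x y z : G) : lconj (lconj x y) (lconj x z) = lconj (x * y) z.
  by rewrite lconjJ /lconj mulgVK.
apply: (mulgI (tensor (lconj g g') (lconj g h))).
apply: (mulIg (tensor (lconj h g) (lconj h h'))).
transitivity (tensor (g * g') (h * h')).
  rewrite tensorMl lconjM (tensorMr _ (lconj g h)) (tensorMr g) !lconjl.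
  by rewrite !mulgA.
rewrite tensorMr tensorMl lconjM (tensorMl (lconj h g)) !lconjl.
by rewrite !mulgA.
Qed.

Lemma lconj_tensor g h a b :
  lconj (tensor g h) (tensor a b) =
  tensor (lconj [~ g^-1, h^-1] a) (lconj [~ g^-1, h^-1] b).
Proof.
have := tensor_exchange g (lconj (h * g)^-1 a) h (lconj (h * g)^-1 b).
rewrite !lconjK !lconjJ => /(canRL (mulgK _)); rewrite /(lconj (tensor _ _)) => <-.
by rewrite /commg /conjg !invgK invgM !mulgA.
Qed.

Definition tensor_diagonal : set tensor_square :=
  generated [set t | exists x, t = tensor x x].

Lemma tensor_diagonal_lconj t u :
  tensor_diagonal u -> tensor_diagonal (lconj t u).
Proof.
pose good (s : tensor_square) := forall v, tensor_diagonal v ->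
  tensor_diagonal (lconj s v).
have goodM s s' : good s -> good s' -> good (s * s').
  by move=> gs gs' v Dv; rewrite -(lconjJ s s' v); apply: gs; apply: gs'.
have good_gen s : (forall x, tensor_diagonal (lconj s (tensor x x))) -> good s.
  move=> gs; pose A := [set v | tensor_diagonal (lconj s v)].
  apply: (@generated_min _ _ A) => [|_ [x ->]]; last exact: gs.
  have [D1 DM DV] := generated_subgroup [set t | exists x, t = tensor x x].
  split=> [|x y Dx Dy|x Dx]; rewrite /A /=.
  - by rewrite /lconj mulg1 mulgV.
  - by rewrite lconjM; apply: DM.
  - by have := DV _ Dx; rewrite /lconj !invgM invgK mulgA.
have diag x : tensor_diagonal (tensor x x) by apply: sub_generated; exists x.
have good_tensor g h : good (tensor g h).
  by apply: good_gen => x; rewrite lconj_tensor.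
have good_tensorV g h : good (tensor g h)^-1.
  apply: good_gen => x; set c := [~ g^-1, h^-1].
  rewrite -[x](lconjK c) -lconj_tensor lconjJ mulVg.
  by rewrite {1}/lconj mul1g invg1 mulg1.
move: u; rewrite -/(good t) -(pclass_repr t).
elim: (repr t) => [v Dv|[b [g h]] w IHw].
  by rewrite [pclass _ _](_ : _ = 1) // /lconj mul1g invg1 mulg1.
rewrite -cat1s pclassM; apply: goodM => //; case: b; first exact: good_tensor.
rewrite [pclass _ _](_ : _ = (tensor g h)^-1) //.
apply: (mulIg (tensor g h)); rewrite mulVg -pclassM.
by apply/pclassP; exact: (wc_cancel tensor_rel false (g, h)).
Qed.

Definition tensor_diagonal_normal : normal_subgroup tensor_square :=
  NormalSubgroup (generated_subgroup _) tensor_diagonal_lconj.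

Definition exterior_square : groupType := quotient_group tensor_diagonal_normal.

End TensorSquare.

(* Main.v *)
Require Import Defs.
From HB Require Import structures.
From mathcomp Require Import all_boot.
From mathcomp Require Import boolp classical_sets.

Set Implicit Arguments.
Unset Strict Implicit.
Unset Printing Implicit Defensive.

Local Open Scope classical_set_scope.
Local Open Scope group_scope.

(** Let [T] be the exterior square of [G], [kappa : T -> G] the commutator map
    and let [G] act on [T] through conjugation of both arguments.  These form
    a crossed module: [kappa s] acts on [T] as conjugation by [s], and
    [wedge (kappa t) g = t * (act g t)^-1].  Hence the kernel of [kappa] is
    central and fixed by [G]; if [G] has exponent [p], this applies to all
    [p]-th powers of elements of [T].  Exponent 2 forces [G] to be abelian, so
    only odd [p] matters.

    Filter [T] by the subgroups [wedge_derived n], generated by the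
    [wedge c g] with [c] in the [n]-th derived subgroup [D n] of [G].  Raising
    to the power [p] maps [T] into [wedge_derived 2] and [wedge_derived n]
    into [wedge_derived n.+1] for [n > 0].  As [wedge_derived d] is trivial,
    [p ^ (d - 1)] kills [T].

    The second inclusion is soft.  Modulo [wedge_derived n.+1], the elements
    [t] with [kappa t] in [D n] generate a group of class 2 whose commutators
    have exponent [p], so that [p]-th powers are multiplicative there
    ([q_expM]); and [wedge (kappa t) g = t * (act g t)^-1] dies because
    [t ^+ p] is fixed by [G] ([q_wedge_kappa_exp]).

    The first inclusion is the metabelian case, where a factor [p] is
    saved: modulo [wedge_derived 2], each [c = wedge x y] satisfies
    [c ^+ p = 1] ([q_wedge_exp]).  The elements of [G] act on [c], up to
    commutators, through the exponents [(i, j)] modulo [p] of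
    [x ^+ i * y ^+ j], which are the points of an affine plane.  The product
    of the translates of [c] is 1 along each line through the origin of slope
    [j], because [wedge ((x * y ^+ j) ^+ p) y = 1], and along each vertical
    line, because [wedge x (y ^+ p) = 1].  The [p] lines of finite slope
    through the origin cover the origin [p] times, and the points off the
    vertical axis once each; the latter also make up [p.-1] vertical lines.
    So [c ^+ p = 1] as soon as the translates of [c] commute
    ([pencil_of_lines]).

    They do not commute, but the commutator of [act g c] and [act h c] is
    central and depends only on [g^-1 * h] modulo commutators; inverting both
    [x] and [y] inverts it.  So the argument applies to the pairs formed by a
    translate of [c] and the corresponding translate of
    [c' = wedge x^-1 y^-1], in the square of the group with each [(z, z^-1)],
    [z] central, made trivial ([twisted_square]).  It gives
    [c ^+ p * c' ^+ p = 1].  But [c'] is a translate of [c], so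
    [c' ^+ p = c ^+ p] and [c ^+ p] has order at most 2.  Its order also
    divides [p], as [wedge (x ^+ n) y] and the [n]-th power of
    [wedge x y] have the same [p]-th power.  Since [p] is odd, [c ^+ p = 1]. *)

(** * Maps out of presented groups and exterior squares *)

Section Morphisms.
Variables (G H : groupType) (f : G -> H).
Hypothesis fM : {morph f : x y / x * y}.

Lemma morph_one : f 1 = 1.
Proof. by apply: (mulIg (f 1)); rewrite -fM !mul1g. Qed.

Lemma morph_inv : {morph f : x / x^-1}.
Proof. by move=> x; apply: (mulIg (f x)); rewrite -fM !mulVg morph_one. Qed.

Lemma morph_exp n : {morph f : x / x ^+ n}.
Proof.
by move=> x; elim: n => [|n IHn]; rewrite ?morph_one // !expgS fM IHn.
Qed.

End Morphisms.

Section PresentedLift.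
Variables (X : choiceType) (R : word X -> word X -> Prop).

Lemma presented_ind (A : set (presented R)) :
  is_subgroup A -> (forall x, A (pclass R [:: (true, x)])) -> forall a, A a.
Proof.
case=> [A1 AM AV] AX a; rewrite -(pclass_repr a).
elim: (repr a) => [|[b x] w Aw]; first exact: A1.
rewrite -cat1s pclassM; apply: AM Aw; case: b => //.
suff -> : pclass R [:: (false, x)] = (pclass R [:: (true, x)])^-1 by apply: AV.
apply: (mulIg (pclass R [:: (true, x)])); rewrite mulVg -pclassM.
by apply/pclassP; exact: (wc_cancel R false x).
Qed.

Variables (K : groupType) (f : X -> K).

Definition eval_word (w : word X) : K :=
  \prod_(l <- w) (if l.1 then f l.2 else (f l.2)^-1).

Definition presented_lift (a : presented R) : K := eval_word (repr a).

Hypothesis f_rel : forall u v, R u v -> eval_word u = eval_word v.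

Lemma eval_word_congr u v : word_congr R u v -> eval_word u = eval_word v.
Proof.
elim=> {u v} //.
- by case=> x; rewrite /eval_word !big_cons big_nil /= mulg1 ?mulgV ?mulVg.
- by move=> u u' v v' _ uE _ vE; rewrite /eval_word !big_cat /=; congr (_ * _).
- by move=> u v w _ -> _ ->.
Qed.

Lemma presented_lift_class w : presented_lift (pclass R w) = eval_word w.
Proof. exact/eval_word_congr/repr_pclass. Qed.

Lemma presented_liftM : {morph presented_lift : a b / a * b}.
Proof.
move=> a b; rewrite -(pclass_repr a) -(pclass_repr b) -pclassM.
by rewrite !presented_lift_class /eval_word big_cat.
Qed.

End PresentedLift.

Section ExteriorSquare.
Variable G : groupType.

Definition wedge (g h : G) : exterior_square G := qclass _ (tensor g h).

Lemma wedge_relMl g g' h :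
  wedge (g * g') h = wedge (lconj g g') (lconj g h) * wedge g h.
Proof. by rewrite /wedge tensorMl qclassM. Qed.

Lemma wedge_relMr g h h' :
  wedge g (h * h') = wedge g h * wedge (lconj h g) (lconj h h').
Proof. by rewrite /wedge tensorMr qclassM. Qed.

Lemma wedgexx g : wedge g g = 1.
Proof.
apply/esym/qclassP; rewrite invg1 mul1g /=.
by apply: sub_generated; exists g.
Qed.

Lemma wedge_ind (A : set (exterior_square G)) :
  is_subgroup A -> (forall g h, A (wedge g h)) -> forall t, A t.
Proof.
case=> [A1 AM AV] Aw t; rewrite -(qclass_repr t).
apply: (@presented_ind _ _ [set s | A (qclass _ s)]) => [|[g h]];
  last exact: Aw.
split=> [|s s' As As'|s As] /=; [exact: A1 | by rewrite qclassM; apply: AM |].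
suff -> : qclass (tensor_diagonal_normal G) s^-1 = (qclass _ s)^-1.
  exact: AV.
by apply: (mulIg (qclass _ s)); rewrite mulVg -qclassM mulVg.
Qed.

Section Lift.
Variables (K : groupType) (f : G -> G -> K).
Hypothesis fMl : forall g g' h,
  f (g * g') h = f (lconj g g') (lconj g h) * f g h.
Hypothesis fMr : forall g h h',
  f g (h * h') = f g h * f (lconj h g) (lconj h h').
Hypothesis fxx : forall g, f g g = 1.

Definition tensor_lift : tensor_square G -> K :=
  @presented_lift _ (@tensor_rel G) K (fun gh => f gh.1 gh.2).

Lemma tensor_lift_rel u v : @tensor_rel G u v ->
  eval_word (fun gh => f gh.1 gh.2) u = eval_word (fun gh => f gh.1 gh.2) v.
Proof.
by rewrite /eval_word => -[g g' h|g h h'];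
   rewrite !big_cons big_nil /= !mulg1; [exact: fMl | exact: fMr].
Qed.

Lemma tensor_liftM : {morph tensor_lift : s t / s * t}.
Proof. exact/presented_liftM/tensor_lift_rel. Qed.

Lemma tensor_liftE g h : tensor_lift (tensor g h) = f g h.
Proof.
rewrite /tensor_lift (presented_lift_class tensor_lift_rel).
by rewrite /eval_word big_seq1.
Qed.

Lemma tensor_lift_diagonal t : tensor_diagonal t -> tensor_lift t = 1.
Proof.
move: t; apply: generated_min => [|_ [x ->]]; last by rewrite /= tensor_liftE.
split=> [|s t /= s1 t1|s /= s1]; rewrite /= ?(morph_one tensor_liftM) //.
  by rewrite tensor_liftM s1 t1 mulg1.
by rewrite (morph_inv tensor_liftM) s1 invg1.
Qed.

Definition wedge_lift (t : exterior_square G) : K := tensor_lift (repr t).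

Lemma wedge_lift_class s : wedge_lift (qclass _ s) = tensor_lift s.
Proof.
have /qclassP/tensor_lift_diagonal :=
  qclass_repr (qclass (tensor_diagonal_normal G) s).
by rewrite tensor_liftM (morph_inv tensor_liftM) => /mulg1_eq; rewrite invgK.
Qed.

Lemma wedge_liftE g h : wedge_lift (wedge g h) = f g h.
Proof. by rewrite wedge_lift_class tensor_liftE. Qed.

Lemma wedge_liftM : {morph wedge_lift : s t / s * t}.
Proof.
move=> s t; rewrite -(qclass_repr s) -(qclass_repr t) -qclassM.
by rewrite !wedge_lift_class tensor_liftM.
Qed.

End Lift.
End ExteriorSquare.

(** * The crossed module of the exterior square *)

Section Conjugation.
Variable G : groupType.
Implicit Types g h x y : G.

(** The commutator convention that goes with the left action [lconj]. *)
Definition lcomm x y : G := x * y * x^-1 * y^-1.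

Lemma lconj1 x : lconj 1 x = x.
Proof. by rewrite /lconj !gnorm. Qed.

Lemma lconj_lconj g x y :
  lconj (lconj g x) (lconj g y) = lconj g (lconj x y).
Proof. by rewrite !lconjJ /lconj mulgVK. Qed.

Lemma lcommMl g g' h :
  lcomm (g * g') h = lcomm (lconj g g') (lconj g h) * lcomm g h.
Proof. by rewrite /lcomm /lconj !gnorm. Qed.

Lemma lcommMr g h h' :
  lcomm g (h * h') = lcomm g h * lcomm (lconj h g) (lconj h h').
Proof. by rewrite /lcomm /lconj !gnorm. Qed.

Lemma lcommxx g : lcomm g g = 1.
Proof. by rewrite /lcomm !gnorm. Qed.

End Conjugation.

Section CrossedModule.
Variable G : groupType.
Local Notation T := (exterior_square G).

Definition kappa : T -> G := wedge_lift (@lcomm G).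

Lemma kappaM : {morph kappa : s t / s * t}.
Proof. exact: (wedge_liftM (@lcommMl G) (@lcommMr G) (@lcommxx G)). Qed.

Lemma kappa_wedge g h : kappa (wedge g h) = lcomm g h.
Proof. exact: (wedge_liftE (@lcommMl G) (@lcommMr G) (@lcommxx G)). Qed.

Definition act (g : G) : T -> T :=
  wedge_lift (fun x y => wedge (lconj g x) (lconj g y)).

Lemma act_subproof (g : G) : let f x y := wedge (lconj g x) (lconj g y) in
  [/\ forall x x' y, f (x * x') y = f (lconj x x') (lconj x y) * f x y,
      forall x y y', f x (y * y') = f x y * f (lconj y x) (lconj y y')
    & forall x, f x x = 1].
Proof.
split=> * /=; last exact: wedgexx.
  by rewrite lconjM wedge_relMl !lconj_lconj.
by rewrite lconjM wedge_relMr !lconj_lconj.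
Qed.

Lemma actM g : {morph act g : s t / s * t}.
Proof. by have [Ml Mr xx] := act_subproof g; apply: wedge_liftM Ml Mr xx. Qed.

Lemma act_wedge g x y : act g (wedge x y) = wedge (lconj g x) (lconj g y).
Proof.
have [Ml Mr xx] := act_subproof g.
exact: (wedge_liftE (f := fun x y => wedge (lconj g x) (lconj g y)) Ml Mr xx).
Qed.

Lemma kappa1 : kappa 1 = 1. Proof. exact: morph_one kappaM. Qed.
Lemma kappaV : {morph kappa : t / t^-1}. Proof. exact: morph_inv kappaM. Qed.
Lemma kappaX n : {morph kappa : t / t ^+ n}.
Proof. exact: morph_exp kappaM n. Qed.
Lemma act1r g : act g 1 = 1. Proof. exact: morph_one (actM g). Qed.
Lemma actV g : {morph act g : t / t^-1}. Proof. exact: morph_inv (actM g). Qed.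
Lemma actX g n : {morph act g : t / t ^+ n}.
Proof. exact: morph_exp (actM g) n. Qed.

Lemma wedge_morph_ext (K : groupType) (f g : T -> K) :
  {morph f : s t / s * t} -> {morph g : s t / s * t} ->
  (forall x y, f (wedge x y) = g (wedge x y)) -> f =1 g.
Proof.
move=> fM gM fg; apply: wedge_ind fg.
split=> [|s t fs ft|s fs] /=; first by rewrite !morph_one.
  by rewrite fM gM fs ft.
by rewrite (morph_inv fM) (morph_inv gM) fs.
Qed.

Lemma actJ g h t : act g (act h t) = act (g * h) t.
Proof.
move: t; apply: (@wedge_morph_ext _ (act g \o act h)) => [s t|s t|x y] /=.
- by rewrite !actM.
- by rewrite actM.
- by rewrite !act_wedge !lconjJ.
Qed.

Lemma act1 t : act 1 t = t.
Proof.
move: t; apply: (@wedge_morph_ext _ _ id) => [s t|//|x y] /=.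
  by rewrite actM.
by rewrite !act_wedge !lconj1.
Qed.

Lemma actK g t : act g^-1 (act g t) = t.
Proof. by rewrite actJ mulVg act1. Qed.

Lemma kappa_act g t : kappa (act g t) = lconj g (kappa t).
Proof.
move: t; apply: (@wedge_morph_ext _ (kappa \o act g) (lconj g \o kappa))
  => [s t|s t|x y] /=.
- by rewrite actM kappaM.
- by rewrite kappaM lconjM.
- by rewrite act_wedge !kappa_wedge /lcomm /lconj !gnorm.
Qed.

Lemma lconj_wedge g h a b :
  lconj (wedge g h) (wedge a b) = act (lcomm g h) (wedge a b).
Proof.
have -> : lcomm g h = [~ g^-1, h^-1] by rewrite /lcomm /commg /conjg !gnorm.
rewrite act_wedge /wedge -lconj_tensor /lconj !qclassM; congr (_ * _).
apply: (mulIg (qclass (tensor_diagonal_normal G) (tensor g h))).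
by rewrite mulVg -qclassM mulVg.
Qed.

Lemma act_kappa s t : act (kappa s) t = lconj s t.
Proof.
move: s t; apply: wedge_ind => [|g h].
  split=> [t|r s rt st t|s st t] /=.
  - by rewrite kappa1 act1 lconj1.
  - by rewrite kappaM -actJ st rt lconjJ.
  - by rewrite kappaV -{1}(lconjK s t) -st actK.
apply: (wedge_morph_ext (actM _)) => [s t|x y]; first exact: lconjM.
by rewrite kappa_wedge -lconj_wedge.
Qed.

Lemma wedgeMl g g' h : wedge (g * g') h = act g (wedge g' h) * wedge g h.
Proof. by rewrite wedge_relMl act_wedge. Qed.

Lemma wedgeMr g h h' : wedge g (h * h') = wedge g h * act h (wedge g h').
Proof. by rewrite wedge_relMr act_wedge. Qed.

Lemma wedge1g h : wedge (1 : G) h = 1.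
Proof.
by apply: (mulIg (wedge 1 h)); rewrite -{1}(act1 (wedge 1 h)) -wedgeMl !mul1g.
Qed.

Lemma wedgeg1 g : wedge g (1 : G) = 1.
Proof.
by apply: (mulgI (wedge g 1)); rewrite -{2}(act1 (wedge g 1)) -wedgeMr !mulg1.
Qed.

Lemma wedgeVl g h : wedge g^-1 h = act g^-1 (wedge g h)^-1.
Proof.
have := wedge1g h; rewrite -(mulgV g) wedgeMl => /mulg1_eq.
by move/(congr1 (act g^-1)); rewrite !actV actK => /(canRL invgK).
Qed.

Lemma wedgeVr g h : wedge g h^-1 = act h^-1 (wedge g h)^-1.
Proof.
have := wedgeg1 g; rewrite -(mulgV h) wedgeMr => /mulg1_eq.
by move/(congr1 (act h^-1)); rewrite actK.
Qed.

(** Both sides are crossed homomorphisms of [t] for the action of [T] on itself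
    by conjugation, which reduces the identity to [t = wedge g h].  There,
    [lcomm g h] is the product of [g] and a conjugate of [g^-1], and what
    remains is the comparison of the two expansions of [wedge g (k * h)]. *)
Lemma wedge_kappal t k : wedge (kappa t) k = t * (act k t)^-1.
Proof.
move: t; apply: wedge_ind => [|g h].
  split=> [|s t sE tE|s sE] /=; first by rewrite kappa1 wedge1g act1r mulgV.
    by rewrite kappaM wedgeMl sE tE act_kappa actM /lconj !gnorm.
  by rewrite kappaV wedgeVl sE -kappaV act_kappa actV /lconj !gnorm.
(* The second expansion comes from [k * h = h * (h^-1 * k * h)]. *)
have exch : act h (wedge g (lconj h^-1 k)) =
            (wedge g h)^-1 * wedge g k * act k (wedge g h).
  apply: (mulgI (wedge g h)); rewrite !gnorm -!wedgeMr.
  by rewrite /lconj !gnorm.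
rewrite kappa_wedge.
have -> : lcomm g h = g * lconj h g^-1 by rewrite /lcomm /lconj !gnorm.
rewrite wedgeMl.
have -> : wedge (lconj h g^-1) k = act h (wedge g^-1 (lconj h^-1 k)).
  by rewrite act_wedge lconjK.
rewrite wedgeVl !actJ.
have -> : g * h * g^-1 = kappa (wedge g h) * h.
  by rewrite kappa_wedge /lcomm !gnorm.
by rewrite -actJ actV exch act_kappa /lconj !gnorm.
Qed.

End CrossedModule.

(** * Products of commuting families *)

(** Functions of sequences that ignore the order.  Beyond products of commuting
    families, this serves for functions of a noncommutative product that do not
    see commutators. *)
Lemma perm_swap_eq (A : eqType) B (f : seq A -> B) :
    (forall u a b v, f (u ++ [:: a, b & v]) = f (u ++ [:: b, a & v])) ->
  forall s t, perm_eq s t -> f s = f t.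
Proof.
move=> f_swap.
have f_move u a v w : f (u ++ a :: v ++ w) = f (u ++ v ++ a :: w).
  elim: v u => //= b v IHv u; rewrite f_swap.
  by have := IHv (rcons u b); rewrite !cat_rcons.
suff f_perm s t u : perm_eq s t -> f (u ++ s) = f (u ++ t).
  by move=> s t /(f_perm _ _ [::]).
elim: s t u => [|a s IHs] t u; first by rewrite perm_sym => /perm_nilP ->.
move=> st; have /splitPr : a \in t by rewrite -(perm_mem st) mem_head.
case Dt: _ / => [t1 t2]; rewrite -f_move.
have {}st : perm_eq s (t1 ++ t2).
  rewrite -(perm_cons a) (perm_trans st) // Dt perm_catC /= perm_cons.
  by rewrite perm_catC.
by have := IHs _ (rcons u a) st; rewrite !cat_rcons.
Qed.

Section CommutingProducts.
Variables (I : eqType) (P : groupType).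

Lemma perm_prod_commute (F : I -> P) : (forall i j, commute (F i) (F j)) ->
  forall s t, perm_eq s t -> \prod_(i <- s) F i = \prod_(i <- t) F i.
Proof.
move=> FC; apply: perm_swap_eq => u a b v.
by rewrite !big_cat !big_cons /= !(mulgA (F _)) FC.
Qed.

Lemma exchange_prod_commute (J : eqType) (F : I -> J -> P) r s :
    (forall i j k l, commute (F i j) (F k l)) ->
  \prod_(i <- r) \prod_(j <- s) F i j = \prod_(j <- s) \prod_(i <- r) F i j.
Proof.
move=> FC; elim: r => [|i r IHr].
  by rewrite big_nil big1 // => j _; rewrite big_nil.
rewrite big_cons IHr -prodgM_commute => [|j k _ _].
  by apply: eq_bigr => j _; rewrite big_cons.
by apply: commute_prod => l _; apply: FC.
Qed.

End CommutingProducts.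

Section Power.
Variable P : groupType.

Lemma expgM_class2 (x y z : P) n :
    y * x = x * y * z -> commute z x -> commute z y ->
  (x * y) ^+ n = x ^+ n * y ^+ n * z ^+ 'C(n, 2).
Proof.
move=> yx zx zy.
have zXy m : z ^+ m * y = y * z ^+ m.
  exact/esym/commuteX/commute_sym.
have yXx m : y ^+ m * x = x * y ^+ m * z ^+ m.
  elim: m => [|m IHm]; first by rewrite !mulg1 mul1g.
  rewrite !expgSr -mulgA yx !mulgA IHm -(mulgA _ (z ^+ m) y) zXy.
  by rewrite !mulgA.
elim: n => [|n IHn]; first by rewrite !mulg1.
rewrite expgSr IHn binS bin1 -mulgA.
have zXxy m : commute (z ^+ m) (x * y).
  by apply/commute_sym/commuteX/commute_sym/commuteM.
rewrite zXxy !mulgA -(mulgA _ (y ^+ n) x) yXx !mulgA -expgSr.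
rewrite -(mulgA _ (z ^+ n) y) zXy !mulgA -(mulgA _ (y ^+ n) y) -expgSr.
by rewrite addnC expgnDr !mulgA.
Qed.

Lemma expgM_odd_class2 (x y z : P) n : odd n -> y * x = x * y * z ->
  commute z x -> commute z y -> z ^+ n = 1 -> (x * y) ^+ n = x ^+ n * y ^+ n.
Proof.
move=> n_odd yx zx zy zn; rewrite (expgM_class2 _ yx zx zy) bin2odd //.
by rewrite expgnA zn expg1n mulg1.
Qed.

(** Think of [e i j] as a mass at the point [(i, j)] of the affine plane over
    the integers modulo [p].  The lines of slopes [0, ..., p.-1] through the
    origin meet the vertical line at abscissa [i] in [p] distinct points,
    except for [i = 0], where they all meet it at the origin. *)
Lemma pencil_of_lines p (e : nat -> nat -> P) : prime p ->
    (forall i j k l, commute (e i j) (e k l)) ->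
    (forall i j, e i (j %% p) = e i j) ->
    (forall i, \prod_(0 <= j < p) e i j = 1) ->
    (forall j, \prod_(0 <= i < p) e i (i * j)%N = 1) ->
  e 0 0 ^+ p = 1.
Proof.
move=> p_pr eC e_mod parallel pencil.
have exch : \prod_(0 <= i < p) \prod_(0 <= j < p) e i (i * j)%N = 1.
  rewrite exchange_prod_commute; last by move=> *; apply: eC.
  by rewrite big1 // => j _; apply: pencil.
have p_gt0 := prime_gt0 p_pr.
move: exch; rewrite (big_ltn p_gt0).
under [X in X * _]eq_bigr => j _ do rewrite mul0n.
rewrite prodg_const_nat subn0 => <-.
rewrite [X in _ * X](_ : _ = 1) ?mulg1 //.
apply: big1_seq => i; rewrite mem_index_iota /= => /andP[i_gt0 lt_ip].
rewrite -[RHS](parallel i).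
have coip : coprime p i by rewrite prime_coprime // gtnNdvd.
under eq_bigr => j _ do rewrite -e_mod.
rewrite -(big_map (fun j => (i * j) %% p)%N predT (e i)) /=.
apply: perm_prod_commute => [j k|]; first exact: eC.
set s := map _ _; have s_uniq : uniq s.
  rewrite map_inj_in_uniq ?iota_uniq // => j k.
  rewrite !mem_index_iota /= => lt_jp lt_kp /eqP.
  wlog le_kj : j k lt_jp lt_kp / k <= j.
    move=> wl; case: (leqP k j) => [|/ltnW] le; first exact: wl.
    by rewrite eq_sym => /wl ->.
  rewrite eqn_mod_dvd ?leq_mul2l ?le_kj ?orbT //.
  rewrite -mulnBr Gauss_dvdr // => p_dvd.
  apply/eqP; rewrite eqn_leq le_kj andbT -subn_eq0; move: p_dvd.
  case: (j - k)%N (leq_ltn_trans (leq_subr k j) lt_jp) => // m lt_mp.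
  by rewrite gtnNdvd.
apply: uniq_perm (iota_uniq _ _) _ => //.
apply: (uniq_min_size s_uniq _ _).2; last by rewrite size_map.
by move=> _ /mapP[j _ ->]; rewrite mem_index_iota ltn_mod.
Qed.

End Power.

(** * The twisted square of a group *)

Section TwistedSquare.
Variable Q : groupType.

Definition central (z : Q) : Prop := forall t, commute z t.

Lemma centralV z : central z -> central z^-1.
Proof. by move=> zC t; apply/commute_sym/commuteV/commute_sym/zC. Qed.

Definition antidiagonal : set (Q * Q)%type :=
  [set u | central u.1 /\ u.2 = u.1^-1].

Lemma antidiagonal_subgroup : is_subgroup antidiagonal.
Proof.
split=> [|[x x'] [y y'] [/= xC ->] [/= yC ->]|[x x'] [/= xC ->]].
- by split=> /= [t|]; rewrite ?invg1 //; apply/commute_sym/commute1.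
- split=> /=; last by rewrite invgM (centralV yC).
  by move=> t; apply/commute_sym/commuteM; apply/commute_sym.
- by split=> //=; apply: centralV.
Qed.

Lemma antidiagonal_lconj (g u : (Q * Q)%type) :
  antidiagonal u -> antidiagonal (lconj g u).
Proof.
move: g u => [g g'] [x x'] [/= xC ->].
suff -> : lconj (g, g') (x, x^-1) = (x, x^-1) :> (Q * Q)%type by [].
by congr (_, _); rewrite /= -?xC -?(centralV xC) !gnorm.
Qed.

(** The central product of two copies of [Q] amalgamated along the centre. *)
Definition twisted_square : groupType :=
  quotient_group (NormalSubgroup antidiagonal_subgroup antidiagonal_lconj).

Definition twin (a b : Q) : twisted_square :=
  qclass (NormalSubgroup antidiagonal_subgroup antidiagonal_lconj) (a, b).

Lemma twinM a b a' b' : twin (a * a') (b * b') = twin a b * twin a' b'.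
Proof. exact: (qclassM _ (a, b) (a', b')). Qed.

Lemma twin_prod I (r : seq I) (F F' : I -> Q) :
  \prod_(i <- r) twin (F i) (F' i) =
  twin (\prod_(i <- r) F i) (\prod_(i <- r) F' i).
Proof.
by elim: r => [|i r IHr]; rewrite !(big_nil, big_cons) // IHr twinM.
Qed.

(** Opposite central commutators in the two components cancel out. *)
Lemma twin_commute z a b a' b' : central z ->
    a * a' = z * (a' * a) -> b * b' = z^-1 * (b' * b) ->
  commute (twin a b) (twin a' b').
Proof.
have cancel w u : central w -> (w * u)^-1 * u = w^-1.
  by move=> wC; rewrite wC invgM mulgVK.
move=> zC aE bE; rewrite /commute -!twinM; apply/qclassP.
by split; rewrite /= aE ?bE !cancel //; apply: centralV.
Qed.

Lemma twin_diag_eq1 a : twin a a = 1 -> a ^+ 2 = 1.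
Proof.
move=> /esym /qclassP [_] /=; rewrite invg1 !mul1g => aE.
by rewrite expg2 {2}aE mulgV.
Qed.

End TwistedSquare.

(** * Wedges of powers *)

Section Wedge.
Variable G : groupType.
Local Notation T := (exterior_square G).
Implicit Types (g h x y : G) (s t : T).

Lemma kappa_lcomm s t : kappa (lcomm s t) = lcomm (kappa s) (kappa t).
Proof. by rewrite /lcomm !kappaM !kappaV. Qed.

Lemma act_lcomm g s t : act g (lcomm s t) = lcomm (act g s) (act g t).
Proof. by rewrite /lcomm !actM !actV. Qed.

Lemma act_prod g I (r : seq I) (F : I -> T) :
  act g (\prod_(i <- r) F i) = \prod_(i <- r) act g (F i).
Proof. exact: (big_morph (act g) (actM g) (act1r g)). Qed.

Lemma wedgeXr x y n :
  wedge x (y ^+ n) = \prod_(0 <= j < n) act (y ^+ j) (wedge x y).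
Proof.
elim: n => [|n IHn]; first by rewrite big_nil wedgeg1.
by rewrite expgSr wedgeMr IHn big_nat_recr.
Qed.

Lemma wedgeXl x y n :
  wedge (x ^+ n) y = \prod_(i <- rev (index_iota 0 n)) act (x ^+ i) (wedge x y).
Proof.
elim: n => [|n IHn]; first by rewrite big_nil wedge1g.
rewrite expgSr wedgeMl IHn /index_iota !subn0 -addn1 iotaD rev_cat big_cat.
by rewrite big_seq1.
Qed.

Lemma wedgeX_self y n : wedge (y ^+ n) y = 1.
Proof. by rewrite wedgeXl big1 // => i _; rewrite wedgexx act1r. Qed.

Lemma wedge_line x y n : wedge (x * y ^+ n) y = wedge x y.
Proof. by rewrite wedgeMl wedgeX_self act1r mul1g. Qed.

Lemma wedgeVV x y : wedge x^-1 y^-1 = act (x^-1 * y^-1) (wedge x y).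
Proof. by rewrite wedgeVl wedgeVr !actV invgK actJ. Qed.

Lemma act_fixed g t : kappa t = 1 -> act g t = t.
Proof.
move=> t1; have := wedge_kappal t g; rewrite t1 wedge1g => /esym/divg1_eq.
exact: esym.
Qed.

End Wedge.

(** * Powers in a quotient of the exterior square *)

Lemma lcommE (H : groupType) (x y : H) : lcomm x y = [~ x^-1, y^-1].
Proof. by rewrite /lcomm /commg /conjg !gnorm. Qed.

Lemma lcommV (H : groupType) (x y : H) : (lcomm x y)^-1 = lcomm y x.
Proof. by rewrite /lcomm !gnorm. Qed.

Lemma lcomm_centralMr (H : groupType) (s z t : H) :
  central z -> lcomm s (z * t) = lcomm s t.
Proof.
move=> zC; have zJ u : lconj z u = u by rewrite /lconj zC mulgK.
by rewrite lcommMr !zJ /lcomm -(zC s) !gnorm.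
Qed.

(** [Q] stands for the quotient of the exterior square by the subgroup generated
    by the [wedge c g] with [c] in [C].  Asking only that [q] be onto and kill
    these generators keeps the cosets out of the computations. *)
Section CentralQuotient.
Variables (G : groupType) (p : nat).
Local Notation T := (exterior_square G).
Hypotheses (p_pr : prime p) (p_odd : odd p) (Gp : forall x : G, x ^+ p = 1).

Variables (Q : groupType) (q : T -> Q).
Hypothesis qM : {morph q : s t / s * t}.
Hypothesis q_surj : forall z, exists t, z = q t.
Variable C : set G.
Hypothesis qC : forall c g, C c -> q (wedge c g) = 1.
Implicit Types (g h x y : G) (s t : T).

Let q1 : q 1 = 1. Proof. exact: morph_one qM. Qed.
Let qV t : q t^-1 = (q t)^-1. Proof. exact: morph_inv qM t. Qed.
Let qX n t : q (t ^+ n) = q t ^+ n. Proof. exact: morph_exp qM n t. Qed.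

Lemma kappa_exp_p t : kappa (t ^+ p) = 1.
Proof. by rewrite kappaX Gp. Qed.

Lemma exp_mod x j : x ^+ (j %% p) = x ^+ j.
Proof.
by rewrite [in RHS](divn_eq j p) expgnDr mulnC expgnA Gp expg1n mul1g.
Qed.

Lemma q_act g t : C (kappa t) -> q (act g t) = q t.
Proof.
move=> /(qC g); rewrite wedge_kappal qM qV => /divg1_eq; exact: esym.
Qed.

Lemma q_central t : C (kappa t) -> central (q t).
Proof.
move=> Ct z; have [s ->] := q_surj z; have := q_act (kappa s) Ct.
by rewrite act_kappa /lconj !qM qV => /(canRL (mulgVK _)).
Qed.

Lemma q_exp_central t : central (q t ^+ p).
Proof.
move=> z; have [s ->] := q_surj z; rewrite -qX /commute -!qM.
have := act_fixed (kappa s) (kappa_exp_p t).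
by rewrite act_kappa => /(canRL (mulgVK _)) ->.
Qed.

Lemma q_act_exp g t : q (act g t) ^+ p = q t ^+ p.
Proof. by rewrite -!qX -actX act_fixed // kappa_exp_p. Qed.

(** The commutator of [s] and [t] is central in [Q], and of exponent [p]
    because [q t ^+ p] is central too; the power of it that appears in
    [(s * t) ^+ p] is a multiple of [p] since [p] is odd. *)
Lemma q_expM s t :
  C [~ kappa t, kappa s] -> q (s * t) ^+ p = q s ^+ p * q t ^+ p.
Proof.
move=> Cts; have zC : central (q [~ t, s]).
  by apply: q_central; rewrite /commg /conjg !kappaM !kappaV.
rewrite qM; apply: (expgM_odd_class2 p_odd (z := q [~ t, s])) => //.
  by rewrite -!qM -commgC.
have : (q t) ^ (q s) = q t * q [~ t, s].
  by rewrite -qM /commg mulVKg /conjg !qM qV.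
move/(congr1 (fun z => z ^+ p)); rewrite -conjXg expgMn; last first.
  exact/commute_sym/zC.
rewrite /conjg q_exp_central mulKg => /esym/(canRL (mulKg _)).
by rewrite mulVg.
Qed.

(** [wedge (kappa t) g] is the quotient of [t] by its translate [act g t], which
    has the same [p]-th power as [t]. *)
Lemma q_wedge_kappa_exp t g :
    C [~ lconj g (kappa t)^-1, kappa t] ->
  q (wedge (kappa t) g) ^+ p = 1.
Proof.
move=> Ct; rewrite wedge_kappal -actV q_expM ?kappa_act ?kappaV //.
by rewrite q_act_exp qV expVgn mulgV.
Qed.

(** * The metabelian case *)

Section Metabelian.
Hypothesis Ckappa : forall s t, C [~ kappa s, kappa t].

Lemma q_lcomm_central s t : C (kappa (lcomm s t)).
Proof. by rewrite kappa_lcomm lcommE -!kappaV. Qed.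

(** The commutator form of [Q]: central, antisymmetric and invariant under [G],
   it does not see the action of commutators of [G] on its arguments. *)
Let omega s t : Q := q (lcomm s t).

Lemma omega_central s t : central (omega s t).
Proof. exact/q_central/q_lcomm_central. Qed.

Lemma omega_swap s t : q s * q t = omega s t * (q t * q s).
Proof. by rewrite /omega -!qM /lcomm !gnorm. Qed.

Lemma omegaV s t : (omega s t)^-1 = omega t s.
Proof. by rewrite /omega -qV lcommV. Qed.

Lemma omega_act g s t : omega (act g s) (act g t) = omega s t.
Proof. by rewrite /omega -act_lcomm q_act //; apply: q_lcomm_central. Qed.

Lemma omega_kappar r s t : omega s (act (kappa r) t) = omega s t.
Proof.
have -> : act (kappa r) t = lcomm r t * t.
  by rewrite act_kappa /lconj /lcomm !gnorm.
have zC := q_central (q_lcomm_central r t).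
have qlcomm u v : q (lcomm u v) = lcomm (q u) (q v) by rewrite /lcomm !(qM, qV).
by rewrite /omega 2!qlcomm qM lcomm_centralMr.
Qed.

Section Pair.
Variables x y : G.
Let c := wedge x y.

Definition Omega g : Q := omega c (act g c).

Lemma omega_Omega g h : omega (act g c) (act h c) = Omega (g^-1 * h).
Proof. by rewrite -(omega_act g^-1) !actJ mulVg act1. Qed.

Lemma Omega_swap a g h b : Omega (a * g * h * b) = Omega (a * h * g * b).
Proof.
have split_act u : Omega (a * u) = omega (act a^-1 c) (act u c).
  by rewrite omega_Omega invgK.
rewrite -!mulgA !split_act.
have -> : g * (h * b) = kappa (wedge g h) * (h * (g * b)).
  by rewrite kappa_wedge /lcomm !gnorm.
by rewrite -actJ omega_kappar.
Qed.

(** [Omega g] depends on [g] only modulo commutators, so it may be computed from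
    any factorization of [g], in any order. *)
Lemma Omega_perm (u v : seq G) : perm_eq u v ->
  Omega (\prod_(g <- u) g) = Omega (\prod_(g <- v) g).
Proof.
move: u v; apply: perm_swap_eq => u g h v.
by rewrite !big_cat !big_cons /= !mulgA Omega_swap.
Qed.

End Pair.

(** The translates of [wedge x y] by elements of the group generated by [x] and
    [y] are indexed by words, so that a word can be read both in [x, y] and in
    [x^-1, y^-1]. *)
Section Words.
Variables x y : G.

Definition letter (a : bool) : G := if a then x else y.
Definition eval_letters (w : seq bool) : G := \prod_(a <- w) letter a.

Lemma eval_letters_cat u v :
  eval_letters (u ++ v) = eval_letters u * eval_letters v.
Proof. by rewrite /eval_letters big_cat. Qed.

(** [x * y] and [y * x] differ by [lcomm x y], which is [kappa (wedge x y)] and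
    thus acts as conjugation by [wedge x y]: the conjugating element is itself
    one of the translates. *)
Lemma act_letters_swap u v :
  act (eval_letters (u ++ [:: true, false & v])) (wedge x y) =
  lconj (act (eval_letters u) (wedge x y))
        (act (eval_letters (u ++ [:: false, true & v])) (wedge x y)).
Proof.
set c := wedge x y; rewrite -act_kappa kappa_act kappa_wedge.
rewrite !eval_letters_cat /eval_letters !big_cons /= actJ; congr (act _ _).
by rewrite /lconj /lcomm !gnorm.
Qed.

End Words.

Section Square.
Variables x y : G.
Let c := wedge x y.
Let c' := wedge x^-1 y^-1.

Let E (w : seq bool) : twisted_square Q :=
  twin (q (act (eval_letters x y w) c)) (q (act (eval_letters x^-1 y^-1 w) c')).

(** Since [c'] is the translate of [c] by [h = x^-1 * y^-1], the commutators in
    both components are values of [Omega x y], at [U^-1 * V] and at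
    [h^-1 * U'^-1 * V' * h], where [U, V] are the values of the words and
    [U', V'] their values after inverting the letters.  Up to the order of the
    factors, [U'^-1] is [U] and [V'] is [V^-1], so the second argument is the
    inverse of the first one; as [omega] is antisymmetric and invariant, the
    commutators are inverse to each other. *)
Lemma E_commute u v : commute (E u) (E v).
Proof.
apply: (twin_commute (z := omega (act (eval_letters x y u) c)
                                 (act (eval_letters x y v) c))).
- exact: omega_central.
- exact: omega_swap.
rewrite omega_swap; congr (_ * _); rewrite omegaV.
rewrite {}/c' wedgeVV !actJ -/c !omega_Omega.
set h := x^-1 * y^-1.
pose l := [seq letter x y a | a <- u].
pose m := [seq (letter x y a)^-1 | a <- v].
have letterV a : letter x^-1 y^-1 a = (letter x y a)^-1 by case: a.
have u'V : (eval_letters x^-1 y^-1 u)^-1 = \prod_(g <- rev l) g.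
  rewrite /eval_letters; under eq_bigr => a _ do rewrite letterV.
  by rewrite prodgV invgK -map_rev big_map.
have v' : eval_letters x^-1 y^-1 v = \prod_(g <- m) g.
  by rewrite big_map; apply: eq_bigr => a _; rewrite letterV.
have vV : (eval_letters x y v)^-1 = \prod_(g <- rev m) g.
  by rewrite -map_rev big_map prodgV revK.
have uE : eval_letters x y u = \prod_(g <- l) g by rewrite big_map.
rewrite invgM u'V v' vV uE !mulgA.
transitivity (Omega x y (\prod_(g <- [:: h^-1] ++ rev l ++ m ++ [:: h]) g)).
  by rewrite !big_cat !big_seq1 /= !mulgA.
transitivity (Omega x y (\prod_(g <- [:: h^-1; h] ++ rev m ++ l) g));
  last first.
  by rewrite !big_cat !big_cons big_nil /= mulg1 mulVg mul1g.
apply: Omega_perm; rewrite /= perm_cons; apply/permP => f.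
rewrite /= !count_cat !count_rev /= addn0 addnA addnC.
by rewrite [(_ + count f m)%N]addnC.
Qed.

Lemma E_perm u v : perm_eq u v -> E u = E v.
Proof.
move: u v; apply: perm_swap_eq => u a b v.
have E_lconj : E (u ++ [:: true, false & v]) =
               E u * E (u ++ [:: false, true & v]) * (E u)^-1.
  apply: (mulIg (E u)); rewrite mulgVK -!twinM -!qM /E !act_letters_swap.
  by rewrite /lconj -/c -/c' !mulgVK.
have E_swap : E (u ++ [:: true, false & v]) = E (u ++ [:: false, true & v]).
  by rewrite E_lconj E_commute mulgK.
by case: a b => -[].
Qed.

Let e i j := E (nseq i true ++ nseq j false).

Lemma eval_grid a b i j :
  eval_letters a b (nseq i true ++ nseq j false) = a ^+ i * b ^+ j.
Proof.
by rewrite eval_letters_cat /eval_letters !big_nseq /letter -!Monoid.iteropE.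
Qed.

(** The product is a translate of the expansion of [wedge x (y ^+ p)]. *)
Lemma e_parallel i : \prod_(0 <= j < p) e i j = 1.
Proof.
have row (a b : G) : \prod_(0 <= j < p) act (a ^+ i * b ^+ j) (wedge a b) = 1.
  under eq_bigr => j _ do rewrite -actJ.
  by rewrite -act_prod -wedgeXr Gp wedgeg1 act1r.
have q_prod F : \prod_(0 <= j < p) q (F j) = q (\prod_(0 <= j < p) F j).
  by rewrite (big_morph q qM q1).
rewrite twin_prod.
under [X in twin X]eq_bigr => j _ do rewrite eval_grid.
under [X in twin _ X]eq_bigr => j _ do rewrite eval_grid.
by rewrite !q_prod !row q1.
Qed.

(** [wedge (x * y ^+ j) y = wedge x y], so the product is, up to its order, the
    expansion of [wedge ((x * y ^+ j) ^+ p) y]. *)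
Lemma e_pencil j : \prod_(0 <= i < p) e i (i * j)%N = 1.
Proof.
pose w := true :: nseq j false.
pose word i := flatten (nseq i w).
have eE i : e i (i * j)%N = E (word i).
  apply: E_perm; apply/permP => a.
  rewrite count_cat !count_nseq count_flatten map_nseq sumn_nseq /= count_nseq.
  by rewrite mulnDl -mulnA (mulnC j).
have eval_word (a b : G) i : eval_letters a b (word i) = (a * b ^+ j) ^+ i.
  elim: i => [|i IHi]; first by rewrite /eval_letters big_nil.
  by rewrite expgS -IHi eval_letters_cat (eval_grid a b 1 j).
pose r := rev (index_iota 0 p).
have line (a b : G) : \prod_(i <- r) act ((a * b ^+ j) ^+ i) (wedge a b) = 1.
  by rewrite -(wedge_line a b j) -wedgeXl Gp wedge1g.
have q_prod F : \prod_(i <- r) q (F i) = q (\prod_(i <- r) F i).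
  by rewrite (big_morph q qM q1).
transitivity (\prod_(i <- r) E (word i)).
  under eq_bigr => i _ do rewrite eE.
  apply: perm_prod_commute => [i k|]; first exact: E_commute.
  by rewrite perm_sym perm_rev.
rewrite twin_prod.
under [X in twin X]eq_bigr => i _ do rewrite eval_word.
under [X in twin _ X]eq_bigr => i _ do rewrite eval_word.
by rewrite !q_prod !line q1.
Qed.

Lemma q_wedge_exp2 : (q c ^+ p) ^+ 2 = 1.
Proof.
apply: twin_diag_eq1.
rewrite -{2}(q_act_exp (x^-1 * y^-1) c) -wedgeVV -/c'.
have e00 : e 0 0 = twin (q c) (q c').
  by rewrite /e /E /eval_letters /= !big_nil !act1.
have <- : e 0 0 ^+ p = twin (q c ^+ p) (q c' ^+ p).
  rewrite e00; elim: (p) => [|n IHn] //; by rewrite !expgS IHn twinM.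
apply: (pencil_of_lines p_pr (e := e)) e_parallel e_pencil => [*|i j].
  exact: E_commute.
by rewrite /e /E !eval_grid !exp_mod.
Qed.

End Square.

Lemma q_wedge_exp x y : q (wedge x y) ^+ p = 1.
Proof.
have f_exp n : q (wedge (x ^+ n) y) ^+ p = (q (wedge x y) ^+ p) ^+ n.
  elim: n => [|n IHn]; first by rewrite wedge1g q1 expg1n.
  by rewrite expgS wedgeMl q_expM // q_act_exp IHn -expgSr.
have := f_exp p; rewrite Gp wedge1g q1 expg1n => /esym fp.
have := q_wedge_exp2 x y; move: fp; move: (q _ ^+ p) => f fp f2.
rewrite -[p]odd_double_half p_odd -mul2n expgnDr expgnA f2 expg1n mulg1 in fp.
exact: fp.
Qed.

End Metabelian.

End CentralQuotient.

(** * The filtration by the derived series *)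

Section DerivedSeries.
Variable G : groupType.
Local Notation T := (exterior_square G).
Implicit Types (g h x y : G) (s t : T).

Lemma derived_subgroup n : is_subgroup (@derived_series G n).
Proof. by case: n => [|n]; [split | apply: generated_subgroup]. Qed.

Lemma derived_lconj n g x :
  @derived_series G n x -> @derived_series G n (lconj g x).
Proof.
elim: n g x => // n IHn g; apply: generated_min => [|_ [x [y [Dx Dy ->]]]].
  have [D1 DM DV] := derived_subgroup n.+1; split=> [|x y /= Dx Dy|x /= Dx].
  - by rewrite /= /lconj mulg1 mulgV.
  - by rewrite lconjM; apply: DM.
  - by have := DV _ Dx; rewrite /= /lconj !gnorm.
apply: sub_generated; exists (lconj g x), (lconj g y); split; try exact: IHn.
by rewrite /lconj /commg /conjg !gnorm.
Qed.

Lemma derived_commg n x y : @derived_series G n x -> @derived_series G n y ->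
  @derived_series G n.+1 [~ x, y].
Proof. by move=> Dx Dy; apply: sub_generated; exists x, y. Qed.

Lemma derived_kappa n x : @derived_series G n.+1 x -> exists t : T, x = kappa t.
Proof.
move: x; apply: generated_min => [|_ [x [y [_ _ ->]]]].
  split=> [|_ _ [s ->] [t ->]|_ [s ->]]; first by exists 1; rewrite kappa1.
    by exists (s * t); rewrite kappaM.
  by exists s^-1; rewrite kappaV.
by exists (wedge x^-1 y^-1); rewrite kappa_wedge lcommE !invgK.
Qed.

Lemma kappa_derived1 t : @derived_series G 1 (kappa t).
Proof.
move: t; apply: wedge_ind => [|g h].
  have [D1 DM DV] := derived_subgroup 1.
  split=> [|s t Ds Dt|s Ds] /=; first by rewrite kappa1.
    by rewrite kappaM; apply: DM.
  by rewrite kappaV; apply: DV.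
by rewrite kappa_wedge lcommE; apply: derived_commg.
Qed.

Definition wedge_derived (n : nat) : set T :=
  generated [set t | exists c g, @derived_series G n c /\ t = wedge c g].

Lemma wedge_derived_lconj n s t :
  wedge_derived n t -> wedge_derived n (lconj s t).
Proof.
rewrite -act_kappa; move: (kappa s) => k; move: t.
apply: generated_min => [|_ [c [g [Dc ->]]]].
  have [D1 DM DV] := generated_subgroup
    [set t | exists c g, @derived_series G n c /\ t = wedge c g].
  split=> [|t u Dt Du|t Dt] /=; first by rewrite act1r.
    by rewrite actM; apply: DM.
  by rewrite actV; apply: DV.
rewrite /= act_wedge; apply: sub_generated.
by exists (lconj k c), (lconj k g); split=> //; apply: derived_lconj.
Qed.

Definition wedge_derived_normal n : normal_subgroup T :=
  NormalSubgroup (generated_subgroup _) (@wedge_derived_lconj n).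

Let q n t := qclass (wedge_derived_normal n) t.

Let qM n : {morph q n : s t / s * t}. Proof. by move=> s t; apply: qclassM. Qed.

Let qP n t : q n t = 1 <-> wedge_derived n t.
Proof.
split=> [/esym/qclassP | Nt]; first by rewrite invg1 mul1g.
by apply/esym/qclassP; rewrite invg1 mul1g.
Qed.

Let q_surj n z : exists t, z = q n t.
Proof. by exists (repr z); rewrite /q qclass_repr. Qed.

Let qC n c g : @derived_series G n c -> q n (wedge c g) = 1.
Proof. by move=> Dc; apply/qP; apply: sub_generated; exists c, g. Qed.

Variable p : nat.
Hypotheses (p_pr : prime p) (p_odd : odd p) (Gp : forall x : G, x ^+ p = 1).

Let q_exp n t : q n t ^+ p = 1 -> wedge_derived n (t ^+ p).
Proof. by rewrite -(morph_exp (@qM n)) => /qP. Qed.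

Lemma exterior_exp_derived2 t : wedge_derived 2 (t ^+ p).
Proof.
apply: q_exp; move: t.
have C2 s t : @derived_series G 2 [~ kappa s, kappa t].
  by apply: derived_commg; apply: kappa_derived1.
apply: wedge_ind => [|x y]; last first.
  exact: (q_wedge_exp p_pr p_odd Gp (@qM 2) (@q_surj 2) (@qC 2) C2).
split=> [|s t /= sp tp|s /= sp].
- by rewrite /= (morph_one (@qM 2)) expg1n.
- by rewrite (q_expM p_odd Gp (@qM 2) (@q_surj 2) (@qC 2)) // sp tp mulg1.
- by rewrite (morph_inv (@qM 2)) expVgn sp invg1.
Qed.

(** The condition on [kappa] makes the [p]-th power multiplicative modulo
    [wedge_derived n.+2]; as [n.+1] is positive, the generators are of the form
    [wedge (kappa t) g]. *)
Lemma wedge_derived_exp n t :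
  wedge_derived n.+1 t -> wedge_derived n.+2 (t ^+ p).
Proof.
move=> Nt; apply: q_exp; move: t Nt.
suff: wedge_derived n.+1 `<=`
    [set t | @derived_series G n.+1 (kappa t) /\ q n.+2 t ^+ p = 1].
  by move=> sub t /sub[].
have [D1 DM DV] := derived_subgroup n.+1.
apply: generated_min => [|_ [c [g [Dc ->]]]].
  split=> [|s t [Ds sp] [Dt tp]|s [Ds sp]].
  - by rewrite /= kappa1 (morph_one (@qM _)) expg1n.
  - rewrite /= kappaM; split; first exact: DM.
    rewrite (q_expM p_odd Gp (@qM _) (@q_surj _) (@qC _)) ?sp ?tp ?mulg1 //.
    exact: derived_commg.
  - rewrite /= kappaV; split; first exact: DV.
    by rewrite (morph_inv (@qM _)) expVgn sp invg1.
have Dgc : @derived_series G n.+1 (lconj g c^-1).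
  by apply: derived_lconj; apply: DV.
split.
  suff -> : kappa (wedge c g) = c * lconj g c^-1 by apply: DM.
  by rewrite kappa_wedge /lcomm /lconj !mulgA.
have [t cE] := derived_kappa Dc; rewrite cE in Dc Dgc *.
apply: (q_wedge_kappa_exp p_odd Gp (@qM _) (@q_surj _) (@qC _)).
exact: derived_commg.
Qed.

Lemma exterior_exp_derived n t : wedge_derived n.+2 (t ^+ (p ^ n.+1)).
Proof.
elim: n => [|n IHn]; first exact: exterior_exp_derived2.
by rewrite expnSr expgnA; apply: wedge_derived_exp.
Qed.

Lemma exterior_exponent n t :
  @derived_series G n.+2 = [set 1] -> t ^+ (p ^ n.+1) = 1.
Proof.
move=> D1; move: (@exterior_exp_derived n t); move: (t ^+ _).
apply: generated_min => [|_ [c [g [+ ->]]]].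
  by split=> [//|s u -> ->|s ->]; rewrite ?mulg1 ?invg1.
by rewrite D1 => ->; apply: wedge1g.
Qed.

End DerivedSeries.

(** * Exponent and derived length *)

Lemma group_exponent_dvd (H : groupType) n :
  0 < n -> (forall x : H, x ^+ n = 1) -> group_exponent H %| n.
Proof.
move=> n_gt0 Hn; rewrite /group_exponent; case: pselect => [ex|[]]; last first.
  by exists n; apply/asboolP.
case: ex_minnP => m /asboolP[m_gt0 Hm] min_m.
rewrite /dvdn eqn0Ngt; apply/negP => r_gt0.
have := ltn_pmod n m_gt0; rewrite ltnNge min_m //; apply/asboolP; split=> // x.
have := Hn x; rewrite {1}(divn_eq n m) expgnDr mulnC expgnA Hm expg1n.
by rewrite mul1g.
Qed.

Lemma exp_group_exponent (H : groupType) :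
  0 < group_exponent H -> forall x : H, x ^+ group_exponent H = 1.
Proof.
rewrite /group_exponent; case: pselect => // ex _.
by case: ex_minnP => m /asboolP[].
Qed.

Lemma derived_length_min (H : groupType) n :
  @derived_series H n = [set 1] -> derived_length H <= n.
Proof.
move=> Hn; rewrite /derived_length; case: pselect => // ex.
by case: ex_minnP => m _; apply; apply/asboolP.
Qed.

Lemma derived_lengthP (H : groupType) :
  is_solvable H -> @derived_series H (derived_length H) = [set 1].
Proof.
move=> [n Hn]; rewrite /derived_length; case: pselect => [ex|[]].
  by case: ex_minnP => m /asboolP.
by exists n; apply/asboolP.
Qed.

Lemma derived_length_exponent2 (H : groupType) :
  (forall x : H, x ^+ 2 = 1) -> derived_length H <= 1.
Proof.
move=> H2; apply: derived_length_min; have [D1 _ _] := derived_subgroup H 1.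
apply/seteqP; split=> [|_ ->]; last exact: D1.
apply: generated_min => [|_ [x [y [_ _ ->]]]].
  by split=> [//|s u -> ->|s ->]; rewrite ?mulg1 ?invg1.
have V (z : H) : z^-1 = z by apply: mulg1_eq; rewrite -expg2.
by have := H2 (x * y); rewrite expg2 /commg /conjg !V !mulgA.
Qed.

Theorem theorem6p2 (G : groupType) (p d : nat) :
  prime p -> is_solvable G -> group_exponent G = p -> derived_length G = d ->
  (1 < d)%N ->
  (odd p ->
     group_exponent (exterior_square G) %| group_exponent G ^ (d - 1)) /\
  (~~ odd p ->
     group_exponent (exterior_square G)
       %| 2 ^ (d - 2) * group_exponent G ^ (d - 1)).
Proof.
move=> p_pr G_sol Gp Gd d_gt1.
have G_exp (x : G) : x ^+ p = 1.
  by rewrite -Gp exp_group_exponent // Gp prime_gt0.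
split=> [p_odd|p_even].
  rewrite Gp; apply: group_exponent_dvd => [|t].
    by rewrite expn_gt0 prime_gt0.
  have := derived_lengthP G_sol; rewrite Gd.
  case: d d_gt1 {Gd} => [|[|n]] // _; rewrite subn1.
  exact: exterior_exponent.
have p2 : p = 2 by case: (even_prime p_pr) p_even => [|->].
have := @derived_length_exponent2 G; rewrite -p2 Gd leqNgt d_gt1.
by move=> /(_ G_exp).
Qed.
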